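(* Let $\mathcal{K}_0\subseteq\mathbb{R}^{n_1}$ and $\mathcal{K}_i\subseteq\mathbb{R}^{n_2}$, $i\in[1:S]$, be nonempty closed convex cones, and let $X\in\mathcal{S}^{n_1}$, $Z_i\in\mathbb{R}^{n_2\times n_1}$, $Y_i\in\mathcal{S}^{n_2}$, $i\in[1:S]$. The partial matrix $$M_*:=\begin{pmatrix}X&Z_1^{\mathsf T}&\cdots&Z_S^{\mathsf T}\\ Z_1&Y_1&\cdots&*\\ \vdots&\vdots&\ddots&\vdots\\ Z_S&*&\cdots&Y_S\end{pmatrix}$$ (all blocks in positions $(Y_i,Y_j)$, $i\neq j$, unspecified) is completable to a matrix in $\mathcal{CPP}(\mathcal{K}_0\times\mathcal{K}_1\times\cdots\times\mathcal{K}_S)$ if and only if there are $r\in\mathbb{N}$ and matrices $\bar X\in\mathcal{K}_0^r$ and $\bar Y_i\in\mathcal{K}_i^r$, $i\in[1:S]$ (with $\bar X$ and $r$ the same for all $i$), such that $$\begin{pmatrix}X&Z_i^{\mathsf T}\\ Z_i&Y_i\end{pmatrix}=\begin{pmatrix}\bar X\bar X^{\mathsf T}&\bar X\bar Y_i^{\mathsf T}\\ \bar Y_i\bar X^{\mathsf T}&\bar Y_i\bar Y_i^{\mathsf T}\end{pmatrix},\quad i\in[1:S];$$ hence, if and only if $$\left[\begin{pmatrix}X&Z_i^{\mathsf T}\\ Z_i&Y_i\end{pmatrix}\right]_{i\in[1:S]}\in\mathcal{CMP}(\mathcal{K}_0,\mathcal{K}_1,\dots,\mathcal{K}_S).$$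
   Context: Notation: $[1:S]=\{1,\dots,S\}$; $\mathcal{S}^m$ is the space of real symmetric $m\times m$ matrices. For a cone $\mathcal{K}\subseteq\mathbb{R}^m$, $\mathcal{K}^r$ denotes the set of $m\times r$ matrices all of whose columns lie in $\mathcal{K}$. A partial matrix is completable to a matrix in a set if its unspecified entries can be chosen so that the resulting full matrix lies in that set. For a closed convex cone $\mathcal{K}\subseteq\mathbb{R}^m$ the set-completely positive cone is $$\mathcal{CPP}(\mathcal{K}):=\left\{\sum_{l=1}^{p}x_lx_l^{\mathsf T} : x_l\in\mathcal{K},\ p\in\mathbb{N}\right\}.$$ $[M_i]_{i\in[1:S]}$ denotes an $S$-tuple of symmetric matrices $M_i=\begin{pmatrix}X&Z_i^{\mathsf T}\\ Z_i&Y_i\end{pmatrix}$ sharing the same upper-left block $X$; such tuples form a vector space (identified with the arrowhead matrices having blocks $X,Z_i,Y_i$). In this space, $$\mathcal{CMP}(\mathcal{K}_0,\dots,\mathcal{K}_S):=\operatorname{conv}\left\{\left[\begin{pmatrix}x\\ y_i\end{pmatrix}\begin{pmatrix}x\\ y_i\end{pmatrix}^{\mathsf T}\right]_{i\in[1:S]} : x\in\mathcal{K}_0,\ y_i\in\mathcal{K}_i,\ i\in[1:S]\right\}.$$ *)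

(* Defs.v *)
From HB Require Import structures.
From mathcomp Require Export all_boot all_order all_algebra.
From mathcomp Require Export all_classical all_reals all_analysis.
Export numFieldNormedType.Exports.

Set Implicit Arguments.
Unset Strict Implicit.
Unset Printing Implicit Defensive.

Import Order.TTheory GRing.Theory Num.Theory.

Local Open Scope classical_set_scope.
Local Open Scope ring_scope.

Definition convex_hull (R : numDomainType) (V : lmodType R) (A : set V) : set V :=
  smallest (@convex_set R V) A.

(* Scaling by positive factors only: a nonempty closed cone contains 0 anyway,
   so this agrees with the convention that also allows the factor 0. *)
Definition closed_convex_cone (R : realType) (m : nat) (K : set 'cV[R]_m) : Prop :=
  [/\ closed K, convex_set K & forall (t : R) x, 0 < t -> K x -> K (t *: x)].

Definition cols_in (R : realType) (m : nat) (K : set 'cV[R]_m) (r : nat) :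
    set 'M[R]_(m, r) :=
  [set A | forall l : 'I_r, K (col l A)].

Definition CPP (R : realType) (m : nat) (K : set 'cV[R]_m) : set 'M[R]_m :=
  [set M | exists (p : nat) (x : 'I_p -> 'cV[R]_m),
     (forall l, K (x l)) /\ M = \sum_(l < p) x l *m (x l)^T].

(* K_0 x K_1 x ... x K_S, its elements being stacked into column vectors. *)
Definition cone_prod (R : realType) (n1 n2 S : nat) (K0 : set 'cV[R]_n1)
    (K : 'I_S -> set 'cV[R]_n2) : set 'cV[R]_(n1 + \sum_(i < S) n2) :=
  [set v | exists (x : 'cV[R]_n1) (y : 'I_S -> 'cV[R]_n2),
     [/\ K0 x, forall i, K i (y i) & v = col_mx x (\mxcol_(i < S) y i)]].

(* The tuples of symmetric matrices sharing their upper-left block form a linear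
   subspace of {ffun 'I_S -> 'M_(n1 + n2)}. The generators lie in it, so the hull
   taken in the full space is the hull taken in the subspace. *)
Definition CMP (R : realType) (n1 n2 S : nat) (K0 : set 'cV[R]_n1)
    (K : 'I_S -> set 'cV[R]_n2) : set {ffun 'I_S -> 'M[R]_(n1 + n2)} :=
  convex_hull [set T | exists (x : 'cV[R]_n1) (y : 'I_S -> 'cV[R]_n2),
     [/\ K0 x, forall i, K i (y i)
       & T = [ffun i => col_mx x (y i) *m (col_mx x (y i))^T]]].

(* In a partial matrix, the entry None is unspecified. *)
Definition completable (R : Type) (m n : nat) (P : 'M[option R]_(m, n))
    (C : set 'M[R]_(m, n)) : Prop :=
  exists2 M : 'M[R]_(m, n),
    C M & forall i j a, P i j = Some a -> M i j = a.

Definition specified (R : Type) (m n : nat) (A : 'M[R]_(m, n)) :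
    'M[option R]_(m, n) := map_mx Some A.

Definition unspecified (R : Type) (m n : nat) : 'M[option R]_(m, n) :=
  const_mx None.

Definition arrowhead (R : Type) (n1 n2 S : nat) (X : 'M[R]_n1)
    (Z : 'I_S -> 'M[R]_(n2, n1)) (Y : 'I_S -> 'M[R]_n2) :
    'M[option R]_(n1 + \sum_(i < S) n2) :=
  block_mx
    (specified X)
    (\mxrow_(j < S) specified (Z j)^T)
    (\mxcol_(i < S) specified (Z i))
    (\mxblock_(i < S, j < S)
       (if i == j then specified (Y i) else unspecified R n2 n2)).

(* Main.v *)
(** A point of [CPP (K0 x K1 x ... x KS)] is a sum of rank-one matrices
    [v_l v_l^T] with [v_l = (x_l, y_{1l}, ..., y_{Sl})].  The specified entries
    of the partial matrix are exactly those of the [S] principal submatrices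
    indexed by the blocks [0] and [i], and there the sum reads
    [\sum_l (x_l, y_{il}) (x_l, y_{il})^T], which is the factorization with
    [x_l], [y_{il}] as the columns of [Xb], [Yb i].  The generators of [CMP] form
    a set containing [0] and stable under positive scaling (scale [x] and [y] by
    the square root), so their convex hull consists of their finite sums. *)
Require Import Defs.
Import Order.TTheory GRing.Theory Num.Theory.
Local Open Scope classical_set_scope.
Local Open Scope ring_scope.

Set Implicit Arguments.
Unset Strict Implicit.
Unset Printing Implicit Defensive.

(** * Convex hulls of sets stable under positive scaling *)

Lemma convE (R : numDomainType) (V : lmodType R) (t : {i01 R})
    (x y : convex_lmodType V) :
  conv t x y = t%:num *: (x : V) + (1 - t%:num) *: (y : V) :> V.
Proof. by []. Qed.

Lemma convex_hull_sub (R : numDomainType) (V : lmodType R) (A : set V) :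
  A `<=` convex_hull A.
Proof. by move=> v Av B [_]; apply. Qed.

Lemma convex_hull_min (R : numDomainType) (V : lmodType R) (A B : set V) :
  convex_set B -> A `<=` B -> convex_hull A `<=` B.
Proof. by move=> cB AB v; apply. Qed.

Lemma convex_hull_convex (R : numDomainType) (V : lmodType R) (A : set V) :
  @convex_set R V (convex_hull A).
Proof.
move=> x y t /set_mem hx /set_mem hy; apply/mem_set => B [cB AB].
by apply/set_mem/cB; apply/mem_set; [apply: hx|apply: hy].
Qed.

Section HullOfScalingStableSet.
Context {R : realFieldType} {V : lmodType R} {A : set V}.
Context (A0 : A 0)
  (AZ : forall (t : R) v, 0 < t -> A v -> A (t *: v)).

(** The preimage of the hull under scaling by [t] is convex and contains [A], so minimality of the
    hull applies. *)
Lemma convex_hullZ (t : R) v : 0 < t -> convex_hull A v -> convex_hull A (t *: v).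
Proof.
move=> t0; apply: (@convex_hull_min _ _ A [set w | convex_hull A (t *: w)]).
  move=> x y k /set_mem /= hx /set_mem /= hy; apply/mem_set => /=.
  have := @convex_hull_convex _ _ A _ _ k (mem_set hx) (mem_set hy).
  move/set_mem; rewrite convE !scalerDr !scalerA.
  by rewrite ![_ * t]mulrC.
by move=> w /(AZ t0) /convex_hull_sub.
Qed.

(** The sum is the midpoint of [2 *: v] and [2 *: w], which both lie in the hull. *)
Lemma convex_hullD v w :
  convex_hull A v -> convex_hull A w -> convex_hull A (v + w).
Proof.
have two0 : (0 : R) < 2 by rewrite ltr0n.
move=> /(convex_hullZ two0)/mem_set hv /(convex_hullZ two0)/mem_set hw.
have h0 : (0 : R) <= 2^-1 by rewrite invr_ge0 ler0n.
have h1 : (2^-1 : R) <= 1 by rewrite invf_le1 ?ltr0n// ler1n.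
have := @convex_hull_convex _ _ A _ _ (Itv01 h0 h1) hv hw.
move/set_mem; rewrite convE /= !scalerA.
have -> : 1 - 2^-1 = 2^-1 :> R.
  by apply/eqP; rewrite subr_eq -mulr2n -[_ *+ 2]mulr_natr mulVf ?pnatr_eq0.
by rewrite mulVf ?pnatr_eq0// !scale1r.
Qed.

Lemma convex_hull_sumsP v :
  convex_hull A v <->
  exists (p : nat) (x : 'I_p -> V), (forall l, A (x l)) /\ v = \sum_(l < p) x l.
Proof.
split=> [|[p [x [Ax ->]]]]; last first.
  apply: big_ind => [||l _]; first exact: convex_hull_sub.
    exact: convex_hullD.
  exact: convex_hull_sub.
pose sums := [set w | exists (p : nat) (x : 'I_p -> V),
  (forall l, A (x l)) /\ w = \sum_(l < p) x l].
apply: (@convex_hull_min _ _ A sums) => [|w Aw]; last first.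
  by exists 1%N, (fun=> w); rewrite big_ord1.
(* It suffices to treat weights strictly between 0 and 1. Both are then positive, so [AZ] absorbs
   them into the summands, and the two families are concatenated. *)
apply/convex_setW => _ _ /set_mem[p [x [Ax ->]]] /set_mem[q [y [Ay ->]]] k k0 k1.
apply/mem_set; exists (p + q)%N, (fun l => match fintype.split l with
  | inl a => k%:num *: x a | inr b => (1 - k%:num) *: y b end); split.
  by move=> l; case: fintype.split => a; apply: AZ; rewrite // subr_gt0.
rewrite convE !scaler_sumr big_split_ord/=; congr (_ + _); apply: eq_bigr => l _.
  by rewrite (unsplitK (inl l)).
by rewrite (unsplitK (inr l)).
Qed.

End HullOfScalingStableSet.

(** The points [x / (n + 1)] stay in [K] and tend to 0, so closedness gives the claim. *)
Lemma closed_convex_cone0 (R : realType) (m : nat) (K : set 'cV[R]_m) :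
  K !=set0 -> closed_convex_cone K -> K 0.
Proof.
move=> [x Kx] [cK _ KZ].
have xto0 : (fun n : nat => n.+1%:R^-1 *: x) @ \oo --> (0 : 'cV[R]_m).
  rewrite -[X in _ --> X](scale0r x); apply: cvgZl; exact: cvg_harmonic.
apply: (closed_cvg _ cK _ _ xto0); apply: nearW => n.
by apply: KZ => //; rewrite invr_gt0 ltr0n.
Qed.

Lemma mulmx_sum_col (R : comNzRingType) (m n r : nat) (A : 'M[R]_(m, r))
    (B : 'M[R]_(n, r)) :
  A *m B^T = \sum_(l < r) col l A *m (col l B)^T.
Proof.
apply/matrixP => i j; rewrite !mxE summxE; apply: eq_bigr => l _.
by rewrite !mxE big_ord1 !mxE.
Qed.

Lemma col_mx_tr_mul (R : comNzRingType) (m n r : nat) (A : 'M[R]_(m, r))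
    (B : 'M[R]_(n, r)) :
  col_mx A B *m (col_mx A B)^T =
  block_mx (A *m A^T) (A *m B^T) (B *m A^T) (B *m B^T).
Proof. by rewrite tr_col_mx mul_col_row. Qed.

Lemma col_col_mx (T : Type) (m n r : nat) (A : 'M[T]_(m, r)) (B : 'M[T]_(n, r))
    (l : 'I_r) : col l (col_mx A B) = col_mx (col l A) (col l B).
Proof. by apply/colP => k; rewrite !mxE; case: fintype.split => a; rewrite mxE. Qed.

(** * The specified entries of the arrowhead matrix *)

Section Arrowhead.
Context {n1 n2 S : nat}.

(* The rows and columns of the arrowhead matrix meeting its [i]-th fully
   specified principal submatrix. *)
Definition arm (i : 'I_S) (a : 'I_(n1 + n2)) : 'I_(n1 + \sum_(j < S) n2) :=
  match fintype.split a with
  | inl b => lshift _ b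
  | inr b => rshift _ (@tagnat.Rank S (fun=> n2) i b)
  end.

Lemma arm_lshift i (b : 'I_n1) : arm i (lshift n2 b) = lshift _ b.
Proof. by rewrite /arm (unsplitK (inl b)). Qed.

Lemma arm_rshift i (b : 'I_n2) :
  arm i (rshift n1 b) = rshift _ (@tagnat.Rank S (fun=> n2) i b).
Proof. by rewrite /arm (unsplitK (inr b)). Qed.

Lemma rowsub_arm (T : Type) (k : nat) (x : 'M[T]_(n1, k))
    (y : 'I_S -> 'M[T]_(n2, k)) (i : 'I_S) :
  rowsub (arm i) (col_mx x (\mxcol_(j < S) y j)) = col_mx x (y i).
Proof.
apply/matrixP => a b; rewrite mxE -[a]splitK; case: (fintype.split a) => c /=.
  by rewrite arm_lshift !col_mxEu.
rewrite arm_rshift !col_mxEd.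
by have /matrixP/(_ c b) := mxcolK y i; rewrite mxE.
Qed.

Lemma mxsub_arm_arrowhead (T : Type) (X : 'M[T]_n1) (Z : 'I_S -> 'M[T]_(n2, n1))
    (Y : 'I_S -> 'M[T]_n2) (i : 'I_S) :
  mxsub (arm i) (arm i) (arrowhead X Z Y) =
  specified (block_mx X (Z i)^T (Z i) (Y i)).
Proof.
apply/matrixP => a b; rewrite mxE [RHS]mxE -[a]splitK -[b]splitK.
case: (fintype.split a) => c; case: (fintype.split b) => d /=;
  rewrite ?arm_lshift ?arm_rshift /arrowhead.
- by rewrite !block_mxEul mxE.
- rewrite !block_mxEur.
  have /matrixP/(_ c d) := mxrowK (fun j => specified (Z j)^T) i.
  by rewrite !mxE.
- rewrite !block_mxEdl.
  have /matrixP/(_ c d) := mxcolK (fun j => specified (Z j)) i.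
  by rewrite !mxE.
- rewrite !block_mxEdr.
  have /matrixP/(_ c d) := mxblockK (fun j k =>
    if j == k then specified (Y j) else unspecified T n2 n2) i i.
  by rewrite eqxx !mxE.
Qed.

Lemma arrowhead_unspecified (T : Type) (X : 'M[T]_n1)
    (Z : 'I_S -> 'M[T]_(n2, n1)) (Y : 'I_S -> 'M[T]_n2) a b :
  (0 < S)%N ->
  arrowhead X Z Y a b = None \/ exists i c d, a = arm i c /\ b = arm i d.
Proof.
move=> S0; rewrite -[a]splitK -[b]splitK.
case: (fintype.split a) => c; case: (fintype.split b) => d /=.
(* An entry of [X] belongs to every arm, so any index serves; [0 < S] provides one. *)
- by right; exists (Ordinal S0), (lshift _ c), (lshift _ d); rewrite !arm_lshift.
- right; exists (tagnat.sig1 d), (lshift _ c), (rshift _ (tagnat.sig2 d)).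
  by rewrite arm_lshift arm_rshift tagnat.sig2K.
- right; exists (tagnat.sig1 c), (rshift _ (tagnat.sig2 c)), (lshift _ d).
  by rewrite arm_lshift arm_rshift tagnat.sig2K.
- have [cd|cd] := eqVneq (tagnat.sig1 c) (tagnat.sig1 d).
    right; exists (tagnat.sig1 c), (rshift _ (tagnat.sig2 c)).
    exists (rshift _ (tagnat.sig2 d)).
    (* [cd] names every block after [d]; undoing it at the first occurrence lets [c] and [d] each be
       rebuilt from its own block. *)
    by rewrite !arm_rshift cd -{1}cd !tagnat.sig2K.
  by left; rewrite /arrowhead block_mxEdr mxE (negbTE cd) mxE.
Qed.

(** The arms cover all specified entries and meet no unspecified one. For [S = 0] the right-hand
    side would be vacuous although [X] is still specified. *)
Lemma completes_arrowheadP (T : Type) (X : 'M[T]_n1) (Z : 'I_S -> 'M[T]_(n2, n1))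
    (Y : 'I_S -> 'M[T]_n2) (M : 'M[T]_(n1 + \sum_(j < S) n2)) :
  (0 < S)%N ->
  (forall a b c, arrowhead X Z Y a b = Some c -> M a b = c) <->
  (forall i, mxsub (arm i) (arm i) M = block_mx X (Z i)^T (Z i) (Y i)).
Proof.
move=> S0; split=> [MP i|MP a b c].
  apply/matrixP => a b; rewrite mxE; apply: MP.
  by have /matrixP/(_ a b) := mxsub_arm_arrowhead X Z Y i; rewrite !mxE.
have [->//|[i [a' [b' [-> ->]]]]] := arrowhead_unspecified X Z Y a b S0.
have /matrixP/(_ a' b') := mxsub_arm_arrowhead X Z Y i.
by rewrite -MP !mxE => -> [].
Qed.

End Arrowhead.

(** * Completions, factorizations and hull points as rank-one sums *)

Section Factorization.
Context {R : realType} {n1 n2 S : nat}.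
Context {K0 : set 'cV[R]_n1} {K : 'I_S -> set 'cV[R]_n2}.

(** The common form to which all three conditions are reduced. The number [p] and the vectors [x l]
    do not depend on [i], which couples the blocks. *)
Definition rank_one_sums (B : 'I_S -> 'M[R]_(n1 + n2)) : Prop :=
  exists (p : nat) (x : 'I_p -> 'cV[R]_n1) (y : 'I_p -> 'I_S -> 'cV[R]_n2),
    [/\ forall l, K0 (x l), forall l i, K i (y l i)
      & forall i, B i = \sum_(l < p) col_mx (x l) (y l i) *m (col_mx (x l) (y l i))^T].

Lemma completable_rank_one_sums (X : 'M[R]_n1) (Z : 'I_S -> 'M[R]_(n2, n1))
    (Y : 'I_S -> 'M[R]_n2) :
  (0 < S)%N ->
  completable (arrowhead X Z Y) (CPP (cone_prod K0 K)) <->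
  rank_one_sums (fun i => block_mx X (Z i)^T (Z i) (Y i)).
Proof.
move=> S0.
(* Restriction to an arm is additive and sends [v *m v^T] to [w *m w^T], where [w] is [v] restricted
   to that arm. *)
have mxsub_sum p (x : 'I_p -> 'cV[R]_n1) (y : 'I_p -> 'I_S -> 'cV[R]_n2) i :
    mxsub (arm i) (arm i)
      (\sum_(l < p) col_mx (x l) (\mxcol_(j < S) y l j) *m
        (col_mx (x l) (\mxcol_(j < S) y l j))^T) =
    \sum_(l < p) col_mx (x l) (y l i) *m (col_mx (x l) (y l i))^T.
  rewrite raddf_sum; apply: eq_bigr => l _ /=.
  by rewrite mxsub_mul -trmx_mxsub !rowsub_arm.
split=> [[M [p [v [vK ->]]] /completes_arrowheadP-/(_ S0) MP]|].
  have /choice[x] := vK => /choice[y xyP].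
  exists p, x, y; split=> [l|l|i]; [by case: (xyP l)|by case: (xyP l)|].
  rewrite -MP -mxsub_sum; congr mxsub; apply: eq_bigr => l _.
  by case: (xyP l) => _ _ <-.
move=> [p [x [y [xK yK xyP]]]].
pose v l := col_mx (x l) (\mxcol_(j < S) y l j).
(* This fills the unspecified block in position [(i, j)] with the sum over [l] of
   [y l i *m (y l j)^T]. *)
exists (\sum_(l < p) v l *m (v l)^T).
  by exists p, v; split=> // l; exists (x l), (y l).
by apply/completes_arrowheadP => // i; rewrite mxsub_sum xyP.
Qed.

Lemma factorization_rank_one_sums (B : 'I_S -> 'M[R]_(n1 + n2)) :
  (exists (r : nat) (Xb : 'M[R]_(n1, r)) (Yb : 'I_S -> 'M[R]_(n2, r)),
     [/\ cols_in K0 Xb, forall i, cols_in (K i) (Yb i)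
       & forall i, B i = block_mx (Xb *m Xb^T) (Xb *m (Yb i)^T)
                                  (Yb i *m Xb^T) (Yb i *m (Yb i)^T)]) <->
  rank_one_sums B.
Proof.
split=> [[r [Xb [Yb [XbK YbK BE]]]]|[p [x [y [xK yK BE]]]]].
  exists r, (fun l => col l Xb), (fun l i => col l (Yb i)).
  split=> [//|l i|i]; first exact: YbK.
  (* With [Xb] stacked on [Yb i], the block matrix is one product of a matrix with its transpose,
     which expands over the columns. *)
  rewrite BE -col_mx_tr_mul mulmx_sum_col.
  by apply: eq_bigr => l _; rewrite col_col_mx.
pose Xb : 'M[R]_(n1, p) := \matrix_(a, l) x l a 0.
pose Yb i : 'M[R]_(n2, p) := \matrix_(a, l) y l i a 0.
have colX l : col l Xb = x l by apply/colP => a; rewrite !mxE.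
have colY l i : col l (Yb i) = y l i by apply/colP => a; rewrite !mxE.
exists p, Xb, Yb; split=> [l|i l|i]; first by rewrite colX.
  by rewrite colY.
rewrite BE -col_mx_tr_mul mulmx_sum_col.
by apply: eq_bigr => l _; rewrite col_col_mx colX colY.
Qed.

Lemma CMP_rank_one_sums (B : 'I_S -> 'M[R]_(n1 + n2)) :
  K0 !=set0 -> closed_convex_cone K0 ->
  (forall i, K i !=set0) -> (forall i, closed_convex_cone (K i)) ->
  CMP K0 K [ffun i => B i] <-> rank_one_sums B.
Proof.
move=> K0ne K0c Kne Kc; rewrite /CMP.
set G := (X in convex_hull X).
have G0 : G 0.
  exists 0, (fun=> 0); split; first exact: closed_convex_cone0.
    by move=> i; exact: closed_convex_cone0.
  by apply/ffunP => i; rewrite !ffunE col_mx0 mul0mx.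
have GZ (t : R) T : 0 < t -> G T -> G (t *: T).
  move=> t0 [x [y [xK yK ->]]].
  have s0 : 0 < Num.sqrt t by rewrite sqrtr_gt0.
  exists (Num.sqrt t *: x), (fun i => Num.sqrt t *: y i); split.
  - by case: K0c => _ _; apply.
  - by move=> i; case: (Kc i) => _ _; apply.
  apply/ffunP => i; rewrite !ffunE -scale_col_mx linearZ/= -scalemxAl -scalemxAr.
  by rewrite scalerA -expr2 sqr_sqrtr// ltW.
split=> [/(convex_hull_sumsP G0 GZ)|[p [x [y [xK yK BE]]]]].
  move=> [p [T [TG BE]]].
  have /choice[x] := TG => /choice[y xyP].
  exists p, x, y; split=> [l|l|i]; [by case: (xyP l)|by case: (xyP l)|].
  move/ffunP/(_ i) : BE; rewrite ffunE sum_ffunE => ->.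
  by apply: eq_bigr => l _; case: (xyP l) => _ _ ->; rewrite ffunE.
apply/(convex_hull_sumsP G0 GZ).
exists p, (fun l => [ffun i => col_mx (x l) (y l i) *m (col_mx (x l) (y l i))^T]).
split=> [l|]; first by exists (x l), (y l).
by apply/ffunP => i; rewrite ffunE sum_ffunE BE; apply: eq_bigr => l _; rewrite ffunE.
Qed.

End Factorization.

Theorem theorem9 (R : realType) (n1 n2 S : nat) (hS : (0 < S)%N)
    (K0 : set 'cV[R]_n1) (K : 'I_S -> set 'cV[R]_n2)
    (K0_ne : K0 !=set0) (K0_cone : closed_convex_cone K0)
    (K_ne : forall i, K i !=set0) (K_cone : forall i, closed_convex_cone (K i))
    (X : 'M[R]_n1) (Z : 'I_S -> 'M[R]_(n2, n1)) (Y : 'I_S -> 'M[R]_n2)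
    (X_sym : X \is symmetricmx) (Y_sym : forall i, Y i \is symmetricmx) :
  (completable (arrowhead X Z Y) (CPP (cone_prod K0 K)) <->
   exists (r : nat) (Xb : 'M[R]_(n1, r)) (Yb : 'I_S -> 'M[R]_(n2, r)),
     [/\ cols_in K0 Xb,
         forall i, cols_in (K i) (Yb i)
       & forall i, block_mx X (Z i)^T (Z i) (Y i) =
                   block_mx (Xb *m Xb^T) (Xb *m (Yb i)^T)
                            (Yb i *m Xb^T) (Yb i *m (Yb i)^T)])
  /\
  (completable (arrowhead X Z Y) (CPP (cone_prod K0 K)) <->
   CMP K0 K [ffun i => block_mx X (Z i)^T (Z i) (Y i)]).
Proof.
(* Both equivalences pass through [rank_one_sums]. *)
split; apply: (iff_trans (completable_rank_one_sums X Z Y hS)); apply: iff_sym.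
  exact: factorization_rank_one_sums.
exact: CMP_rank_one_sums.
Qed.
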